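(* For every integer $t > 1$ there are $(2t+1)$-regular graphs $G_1$ and $G_2$ such that $G_1$ is a class 1 graph, $G_2$ is a class 2 graph, and $F_c(G_1) = F_c(G_2) = 2+\frac{2}{t}$.
   Context: Graphs are finite multigraphs (parallel edges are allowed), with vertex set $V(G)$ and edge set $E(G)$. The edge-chromatic number $\chi'(G)$ is the least number of colors in a proper edge-coloring of $G$, and $\Delta(G)$ is the maximum vertex degree. $G$ is a class 1 graph if $\chi'(G) = \Delta(G)$, and a class 2 graph if $\chi'(G) > \Delta(G)$. For an orientation $D$ of $G$ and $v \in V(G)$, $E^+(v)$ is the set of edges with tail $v$ and $E^-(v)$ is the set of edges with head $v$. For a real number $r \geq 2$, a nowhere-zero $r$-flow on $G$ is an orientation $D$ of $G$ together with a function $\phi : E(G) \to \mathbb{R}$ such that $1 \leq |\phi(e)| \leq r-1$ for all $e \in E(G)$ and $\sum_{e \in E^+(v)}\phi(e) = \sum_{e \in E^-(v)}\phi(e)$ for all $v \in V(G)$. The circular flow number of $G$ is $F_c(G) = \inf\{ r : G \text{ has a nowhere-zero } r\text{-flow}\}$ (with $F_c(G)=\infty$ if $G$ has no nowhere-zero $r$-flow for any $r$). *)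

(* Defs.v *)
From HB Require Import structures.
From mathcomp Require Import all_boot all_order all_algebra.
From mathcomp Require Import all_classical all_reals all_analysis.

Set Implicit Arguments.
Unset Strict Implicit.
Unset Printing Implicit Defensive.

Import Order.TTheory GRing.Theory Num.Theory.

Local Open Scope ring_scope.

(* Finite loopless multigraphs: [ends] need not be injective, which is what
   allows parallel edges. *)
Record multigraph := Multigraph {
  vertex : finType;
  edge : finType;
  ends : edge -> {set vertex};
  card_ends : forall e, #|ends e| = 2%N }.

Definition degree (G : multigraph) (v : vertex G) : nat :=
  #|[set e : edge G | v \in ends e]|.

Definition max_degree (G : multigraph) : nat :=
  (\max_(v : vertex G) degree v)%N.

Definition regular (k : nat) (G : multigraph) : Prop :=
  forall v : vertex G, degree v = k.

Definition proper_edge_coloring (G : multigraph) (k : nat)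
    (c : {ffun edge G -> 'I_k}) : bool :=
  [forall e, forall f,
    (e != f) && (ends e :&: ends f != finset.set0) ==> (c e != c f)].

Definition edge_colorable (G : multigraph) (k : nat) : bool :=
  [exists c : {ffun edge G -> 'I_k}, proper_edge_coloring c].

Lemma edge_colorable_exists (G : multigraph) : exists k, edge_colorable G k.
Proof.
exists #|edge G|; apply/existsP; exists [ffun e => enum_rank e].
apply/forallP => e; apply/forallP => f; apply/implyP => /andP[ef _].
by rewrite !ffunE (inj_eq enum_rank_inj).
Qed.

Definition chromatic_index (G : multigraph) : nat :=
  ex_minn (edge_colorable_exists G).

Definition class1 (G : multigraph) : Prop := chromatic_index G = max_degree G.

Definition class2 (G : multigraph) : Prop :=
  (max_degree G < chromatic_index G)%N.

Record orientation (G : multigraph) := Orientation {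
  edge_tail : edge G -> vertex G;
  edge_head : edge G -> vertex G;
  ends_tail_head :
    forall e, ends e = finset.setU [set edge_tail e]%SET [set edge_head e]%SET }.

Definition nowhere_zero_flow (R : realType) (G : multigraph) (r : R)
    (D : orientation G) (phi : edge G -> R) : Prop :=
  [/\ 2 <= r,
      forall e, 1 <= `|phi e| <= r - 1
    & forall v, \sum_(e | edge_tail D e == v) phi e
              = \sum_(e | edge_head D e == v) phi e].

Definition has_nowhere_zero_flow (R : realType) (G : multigraph) (r : R) : Prop :=
  exists (D : orientation G) (phi : edge G -> R), nowhere_zero_flow r D phi.

(* The infimum is taken in the extended reals, where [ereal_inf set0 = +oo]. *)
Definition circular_flow_number (R : realType) (G : multigraph) : \bar R :=
  ereal_inf [set r%:E | r in [set r : R | has_nowhere_zero_flow G r]]%classic.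

(* Main.v *)
Require Import Defs.
From HB Require Import structures.
From mathcomp Require Import all_boot all_order all_algebra.
From mathcomp Require Import all_classical all_reals all_analysis.
From mathcomp Require Import zify ring lra.

Set Implicit Arguments.
Unset Strict Implicit.
Unset Printing Implicit Defensive.

Import Order.TTheory GRing.Theory Num.Theory.

Local Open Scope ring_scope.

(* Both graphs are prisms over an odd cycle of length 2k + 1 in which every rim edge has
   multiplicity t and every spoke is simple: k = t gives G1 and k = t - 1 gives G2.
   G2 is class 2 because one rim is overfull.  Lower bound: in a flow with r < 2 + 2/t every
   vertex has out-degree minus in-degree equal to 1 or -1, where edges are directed so that
   the flow is positive.  The rim is an odd cycle, so two neighbours on it have the same sign;
   they send only 2t + 2 edges outside, too few to balance their total excess of 2.
   Upper bound: send k + 1 spokes with flow 1 one way and k spokes with flow 1 + 1/k the other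
   way, alternately, and circulate 1 + 1/t plus a correction of at most 1/t along each
   rim edge. *)

(** * Edge colorings: criteria for class 1 and class 2 *)

Section EdgeColoring.
Variables (G : multigraph) (n : nat).

Lemma degree_sum (v : vertex G) : degree v = (\sum_(e : edge G) (v \in ends e))%N.
Proof. by rewrite /degree -sum1dep_card big_mkcond; apply: eq_bigr => e _; case: ifP. Qed.

Lemma proper_edge_coloringP (c : {ffun edge G -> 'I_n}) :
  reflect (forall v, {in [pred e | v \in ends e] &, injective c})
          (proper_edge_coloring c).
Proof.
apply: (iffP forallP) => [cP v e f ve vf cef | cP e].
  apply/eqP/negPn/negP => nef; move/forallP/(_ f)/implyP: (cP e).
  rewrite nef cef eqxx => /(_ _)/negP; apply => //.
  by apply/set0Pn; exists v; rewrite finset.inE; apply/andP.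
apply/forallP => f; apply/implyP => /andP[nef /set0Pn[v]].
rewrite finset.inE => /andP[ve vf]; apply: contra nef => /eqP cef.
by apply/eqP; apply: (cP v).
Qed.

Lemma degree_le_edge_colorable (v : vertex G) : edge_colorable G n -> (degree v <= n)%N.
Proof.
case/existsP => c /proper_edge_coloringP cP; rewrite -[leqRHS]card_ord.
by apply: (@leq_card_in _ _ c) => e f; rewrite !finset.inE; apply: cP.
Qed.

(* Every color class is a matching, so it has at most [#|X|./2] edges inside [X]. *)
Lemma card_induced_edges_le (X : {set vertex G}) :
  edge_colorable G n -> (#|[set e : edge G | ends e \subset X]| <= n * #|X|./2)%N.
Proof.
case/existsP => c /proper_edge_coloringP cP.
rewrite -sum1dep_card (partition_big c xpredT) //= -[n in leqRHS]card_ord.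
rewrite -sum_nat_const; apply: leq_sum => a _.
(* Double counting: both ends of every edge of color [a] lie in [X], and each vertex of [X] meets at
   most one such edge. *)
rewrite geq_half_double -muln2 big_distrl /=.
have -> : (\sum_(e | (ends e \subset X) && (c e == a)) 1 * 2
   = \sum_(e | (ends e \subset X) && (c e == a)) \sum_(v in X) (v \in ends e))%N.
  apply: eq_bigr => e /andP[/finset.setIidPl eX _]; rewrite mul1n -(card_ends e) -[in LHS]eX.
  rewrite -sum1_card big_mkcond [RHS]big_mkcond; apply: eq_bigr => v _.
  by rewrite finset.inE; case: (v \in ends e); case: (v \in X).
rewrite exchange_big /= -sum1_card; apply: leq_sum => v _.
rewrite -big_mkcondr sum1dep_card; apply/card_le1_eqP => e f.
rewrite !finset.inE => /andP[/andP[_ /eqP cea] ve] /andP[/andP[_ /eqP cfa] vf].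
by apply: (cP v) => //; rewrite cea.
Qed.

End EdgeColoring.

(** The vertex [v] rules out the empty graph, so the maximum degree is [n]; the edges at [v] already
    force [n] colors. *)
Lemma class1_regular (G : multigraph) (n : nat) (v : vertex G) :
  regular n G -> edge_colorable G n -> class1 G.
Proof.
move=> rG cG; rewrite /class1.
have -> : max_degree G = n.
  apply/eqP; rewrite eqn_leq -[X in (X <= max_degree G)%N](rG v) leq_bigmax andbT.
  by apply/bigmax_leqP => u _; rewrite rG.
rewrite /chromatic_index; case: ex_minnP => m cm mP.
by apply/eqP; rewrite eqn_leq mP //= -(rG v) degree_le_edge_colorable.
Qed.

(** A coloring with at most [n] colors would split the edges inside [X] into at most [n] matchings,
    too few to cover them. *)
Lemma class2_overfull (G : multigraph) (n : nat) (X : {set vertex G}) :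
  regular n G -> (n * #|X|./2 < #|[set e : edge G | ends e \subset X]|)%N -> class2 G.
Proof.
move=> rG; rewrite /class2 /chromatic_index => oX; case: ex_minnP => m cm _.
apply: leq_ltn_trans (_ : n < m)%N; first by apply/bigmax_leqP => v _; rewrite rG.
rewrite ltnNge; apply/negP => mn; move: oX; rewrite ltnNge => /negP; apply.
by apply: leq_trans (card_induced_edges_le X cm) _; rewrite leq_mul2r mn orbT.
Qed.

(** * Flows, cuts and excess *)

Section Flow.
Variables (R : realType) (G : multigraph) (D : orientation G).
Local Notation tail := (edge_tail D).
Local Notation head := (edge_head D).

(** The codomain is left general because both the real flow and its integer signs are summed this
    way. *)
Definition net_outflow (V : zmodType) (f : edge G -> V) (v : vertex G) : V :=
  \sum_(e | tail e == v) f e - \sum_(e | head e == v) f e.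

Definition cut (X : {set vertex G}) : {set edge G} :=
  [set e | (tail e \in X) != (head e \in X)].

Lemma sum_net_outflow (V : pzRingType) (f : edge G -> V) (X : {set vertex G}) :
  \sum_(v in X) net_outflow f v
  = \sum_e f e * ((tail e \in X)%:R - (head e \in X)%:R).
Proof.
rewrite sumrB.
have E (p : edge G -> vertex G) :
    \sum_(v in X) \sum_(e | p e == v) f e = \sum_e f e * (p e \in X)%:R.
  transitivity (\sum_(e | p e \in X) f e).
    rewrite (partition_big p (mem X)) //=; apply: eq_bigr => v vX.
    by apply: eq_bigl => e; case: eqP => [->|]; rewrite ?vX ?andbF.
  by rewrite big_mkcond; apply: eq_bigr => e _; case: ifP; rewrite ?mulr1 ?mulr0.
by rewrite !E -sumrB; apply: eq_bigr => e _; rewrite mulrBr.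
Qed.

Lemma tail_neq_head (e : edge G) : tail e != head e.
Proof.
have := card_ends e; rewrite (ends_tail_head D) cards2.
by case: (_ != _).
Qed.

Lemma mem_ends (v : vertex G) (e : edge G) :
  (v \in ends e) = (v == tail e) || (v == head e).
Proof. by rewrite (ends_tail_head D) !finset.inE. Qed.

Lemma card_cut1 (v : vertex G) : (#|cut [set v]%SET| <= degree v)%N.
Proof.
apply: subset_leq_card; apply/fintype.subsetP => e; rewrite !finset.inE mem_ends ![_ == v]eq_sym.
by do 2![case: (v == _)].
Qed.

Variables (r : R) (phi : edge G -> R).
Hypothesis flow_phi : nowhere_zero_flow r D phi.

(** Taking signs amounts to reversing the edges of negative flow: this is out-degree minus in-degree
    once the flow is made positive. *)
Definition excess : vertex G -> int := net_outflow (fun e => sgz (phi e)).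

Lemma flow_neq0 e : phi e != 0.
Proof. by case: flow_phi => _ /(_ e) /andP[e1 _] _; rewrite -normr_gt0 (lt_le_trans _ e1). Qed.

(* Compare [phi] with the constant absolute value [r / 2]: the total flow out of [X] vanishes,
   and every edge deviates from [r / 2] by at most [r / 2 - 1]. *)
Lemma excess_le_cut (X : {set vertex G}) :
  `|\sum_(v in X) excess v|%:~R * r <= (r - 2) * #|cut X|%:R :> R.
Proof.
have [r2 phiP phi0] := flow_phi.
pose chi (V : pzRingType) e : V := (tail e \in X)%:R - (head e \in X)%:R.
have phiX : \sum_e phi e * chi R e = 0.
  rewrite -sum_net_outflow big1 // => v _.
  by rewrite /net_outflow phi0 subrr.
suff: `|\sum_(v in X) excess v|%:~R * (r / 2) <= (r / 2 - 1) * #|cut X|%:R :> R by lra.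
rewrite intr_norm sum_net_outflow rmorph_sum /=.
have r20 : `|r / 2| = r / 2 by rewrite ger0_norm //; lra.
rewrite -[X in _ * X <= _]r20 -normrM mulr_suml -[X in `|X|]subr0 -[X in _ - X]phiX -sumrB.
apply: le_trans (ler_norm_sum _ _ _) _.
rewrite -sum1dep_card natr_sum mulr_sumr [leRHS]big_mkcond.
apply: ler_sum => e _.
have -> : (sgz (phi e) * ((tail e \in X)%:R - (head e \in X)%:R))%:~R * (r / 2)
     - phi e * chi R e = Num.sg (phi e) * chi R e * (r / 2 - `|phi e|).
  rewrite [phi e in X in _ - X]numEsg rmorphM /= -sgrEz rmorphB /= !mulrz_nat /chi.
  ring.
rewrite !normrM normr_sg flow_neq0 mul1r /chi mulr1.
have /andP[] := phiP e.
case: (tail e \in X); case: (head e \in X) => /= ? ?;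
  rewrite ?subrr ?normr0 ?mul0r // ?subr0 ?sub0r ?normrN ?normr1 mul1r ler_norml; lra.
Qed.

(** Modulo 2 every sign equals 1, so the excess has the parity of the degree. *)
Lemma odd_excess_neq0 v : odd (degree v) -> excess v != 0.
Proof.
move=> odd_v; suff: (excess v)%:~R != 0 :> 'F_2.
  by apply: contra => /eqP ->.
have sg1 e : (sgz (phi e))%:~R = 1 :> 'F_2.
  by rewrite sgz_def flow_neq0 mulr1n; case: (phi e < 0); apply/eqP.
have -> : (excess v)%:~R = (degree v)%:R :> 'F_2.
  rewrite /excess /net_outflow rmorphB !rmorph_sum /= degree_sum natr_sum.
  rewrite (eq_bigr (fun=> 1)) => [|e _ //]; rewrite [X in _ - X](eq_bigr (fun=> 1)) => [|e _ //].
  have -> (x y : 'F_2) : x - y = x + y.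
    by congr (_ + _); case: y => [[|[|]]] // ?; apply/eqP.
  rewrite big_mkcond [X in _ + X]big_mkcond -big_split; apply: eq_bigr => e _ /=.
  rewrite mem_ends ![_ == v]eq_sym; have := tail_neq_head e.
  case: (v =P tail e) => [->/negPf ->|_ _]; first by rewrite addr0.
  by rewrite add0r; case: ifP.
by rewrite -Zp_nat_mod // modn2 odd_v.
Qed.

End Flow.

(* The prism over a cycle of length [2 * k.+1 + 1], with rim multiplicity [t]. *)
Section Prism.
Variables k t : nat.
Local Notation n := (k.*2.+3).

Definition prism_ends (e : bool * 'I_n * 'I_t + 'I_n) : {set bool * 'I_n} :=
  match e with
  | inl (b, i, _) => [set (b, i); (b, ordS i)]%SET
  | inr i => [set (false, i); (true, i)]%SET
  end.

Arguments prism_ends : simpl never.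

Lemma ordS_neq (i : 'I_n) : i != ordS i.
Proof.
apply/eqP => /(congr1 val) /=; have := ltn_ord i.
rewrite leq_eqVlt => /orP[/eqP Ei|lt_i]; first by rewrite Ei modnn; lia.
by rewrite modn_small //; lia.
Qed.

Lemma card_prism_ends e : #|prism_ends e| = 2%N.
Proof.
by case: e => [[[b i] j]|i]; rewrite cards2 xpair_eqE /= ?eqxx ?ordS_neq.
Qed.

Definition prism : multigraph := Multigraph card_prism_ends.

Lemma mem_prism_rim (b c : bool) (i q : 'I_n) (j : 'I_t) :
  ((b, i) \in prism_ends (inl (c, q, j)))
  = (b == c) && ((i == q) || (i == ordS q)).
Proof. by rewrite !finset.inE !xpair_eqE -andb_orr. Qed.

Lemma mem_prism_spoke (b : bool) (i q : 'I_n) :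
  ((b, i) \in prism_ends (inr q)) = (i == q).
Proof. by rewrite !finset.inE !xpair_eqE; case: b; rewrite //= orbF. Qed.

Lemma big_prism (V : Type) (z : V) (op : Monoid.com_law z) (F : edge prism -> V) :
  \big[op/z]_e F e
  = op (\big[op/z]_b \big[op/z]_i \big[op/z]_j F (inl (b, i, j)))
       (\big[op/z]_i F (inr i)).
Proof.
rewrite big_sumType /=; congr (op _ _).
rewrite pair_bigA pair_bigA /=.
by apply: eq_bigr => [[[b i] j]].
Qed.

Lemma eq_ordS (i q : 'I_n) : (i == ordS q) = (q == ord_pred i).
Proof. by apply/eqP/eqP => ->; rewrite ?ordSK ?ord_predK. Qed.

Lemma regular_prism : regular (2 * t + 1) prism.
Proof.
move=> [b i]; rewrite degree_sum big_prism /=; congr (_ + _)%N.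
  rewrite (bigD1 b) //= [X in (_ + X)%N]big1 => [|c cb]; last first.
    rewrite big1 // => q _; rewrite big1 // => j _.
    by rewrite mem_prism_rim eq_sym (negPf cb).
  under eq_bigr do under eq_bigr do rewrite mem_prism_rim eqxx /=.
  under eq_bigr do rewrite sum_nat_const card_ord.
  rewrite -big_distrr mulnC addn0; congr (_ * _)%N.
  rewrite (bigD1 i) //= eqxx (bigD1 (ord_pred i)) /=; last first.
    by rewrite eq_sym -eq_ordS ordS_neq.
  rewrite ord_predK eqxx orbT big1 // => q /andP[qi qp].
  by rewrite eq_ordS (negPf qp) eq_sym (negPf qi).
under eq_bigr do rewrite mem_prism_spoke.
by rewrite (bigD1 i) //= eqxx big1 // => q qi; rewrite eq_sym (negPf qi).
Qed.

(** * Lower bound for flows on a prism *)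

Section LowerBound.
Variables (R : realType) (r : R) (D : orientation prism) (phi : edge prism -> R).
Hypothesis flow_phi : nowhere_zero_flow r D phi.

(* The [t] parallel edges between two neighbours on a rim do not leave the pair. *)
Lemma card_cut_rim_edge (b : bool) (i : 'I_n) :
  (#|cut D [set ((b, i) : vertex prism); (b, ordS i)]%SET| <= 2 * t + 2)%N.
Proof.
set X := [set _; _]%SET.
have: (#|cut D X| + 2 * t <= degree ((b, i) : vertex prism) + degree ((b, ordS i) : vertex prism))%N.
  (* Spreading [2 * t] over the edges, with weight 2 on each of the [t] parallel ones, allows an
     edge-by-edge comparison. *)
  have -> : (2 * t = \sum_(e : edge prism) 2 * (if e is inl (c, q, _) then (c == b) && (q == i) else false))%N.
    rewrite big_prism /= [X in (_ + X)%N]big1 // addn0 (bigD1 b) //=.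
    rewrite [X in (_ + X)%N]big1 => [|c /negPf ->]; last by rewrite big1 // => q _; rewrite big1.
    rewrite (bigD1 i) //= [X in (_ + X + _)%N]big1 => [|q /negPf ->]; last first.
      by rewrite big1 // => j _; rewrite andbF.
    by rewrite !eqxx sum_nat_const card_ord mulnC !addn0.
  rewrite -sum1_card big_mkcond -big_split /= !degree_sum -big_split /=.
  have uv w : ((b, i) == w) && ((b, ordS i) == w) = false.
    apply/negbTE/negP => /andP[/eqP <-]; rewrite xpair_eqE eqxx eq_sym.
    by rewrite (negPf (ordS_neq i)).
  apply: leq_sum => e _.
  have -> : (e \in cut D X) = (edge_tail D e \in X) (+) (edge_head D e \in X).
    by rewrite finset.inE; do 2!case: (_ \in X).
  have := uv (edge_tail D e); have := uv (edge_head D e).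
  have := mem_ends D (b, i) e; have := mem_ends D (b, ordS i) e.
  rewrite !finset.inE ![_ == (b, _)]eq_sym.
  case: e => [[[c q] j]|q] /=.
    case: (boolP ((c == b) && (q == i))) => [/andP[/eqP -> /eqP ->]|_].
      rewrite !mem_prism_rim !eqxx orbT /=.
      by do 4!case: (_ == _).
    by move=> -> ->; do 4!case: (_ == _).
  by move=> -> ->; do 4!case: (_ == _).
rewrite !regular_prism; lia.
Qed.

Lemma prism_flow_ge : (2 * t + 2)%:R <= t%:R * r.
Proof.
have [r2 _ _] := flow_phi.
rewrite leNgt; apply/negP; rewrite natrD natrM => tr.
have excess1 v : `|excess D phi v| = 1.
  have e0 : excess D phi v != 0.
    by apply: (odd_excess_neq0 flow_phi); rewrite regular_prism; lia.
  apply/eqP; rewrite eq_le -gtz0_ge1 normr_gt0 e0 andbT leNgt; apply/negP => e2.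
  have := excess_le_cut flow_phi [set v]%SET; rewrite big_set1 => le_cut.
  (* This gives [r + 4 * t + 2 <= 2 * t * r < 4 * t + 4], hence [r < 2], a contradiction. *)
  have : 2%:~R * r <= (r - 2) * (2 * t + 1)%:R.
    apply: le_trans (le_trans le_cut _).
      by rewrite ler_wpM2r ?ler_int; lra || lia.
    by rewrite ler_wpM2l ?subr_ge0 // ler_nat -(regular_prism v) card_cut1.
  by rewrite natrD natrM; nra.
pose s (i : 'I_n) := excess D phi ((false, i) : vertex prism).
have [/existsP[i /eqP si]|] := boolP [exists i, s (ordS i) == s i].
  have := excess_le_cut flow_phi [set ((false, i) : vertex prism); (false, ordS i)]%SET.
  rewrite big_setU1 ?big_set1 /=; last by rewrite finset.inE xpair_eqE ordS_neq.
  rewrite -/(s i) -/(s (ordS i)) si -mulr2n normrMn excess1 => le_cut.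
  (* The terms [2 * r] cancel, leaving [2 * t + 2 <= t * r], against the assumption. *)
  have : 2%:~R * r <= (r - 2) * (2 * t + 2)%:R.
    by apply: le_trans le_cut _; rewrite ler_wpM2l ?subr_ge0 // ler_nat card_cut_rim_edge.
  by rewrite natrD natrM; nra.
(* Otherwise the signs alternate around an odd cycle. *)
rewrite negb_exists => /forallP alt.
have sN i : s (ordS i) = - s i.
  move: (alt i) (excess1 (false, i)) (excess1 (false, ordS i)).
  rewrite -/(s i) -/(s (ordS i)); lia.
have : \prod_i s i = - \prod_i s i.
  rewrite [LHS](reindex_inj (can_inj (@ordSK n))) (eq_bigr _ (fun i _ => sN i)).
  by rewrite prodrN card_ord -signr_odd /= odd_double expr1 mulN1r.
move=> prodN; have : \prod_i s i == 0 by lia.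
case/prodf_eq0 => i _ /eqP s0.
by have := excess1 (false, i); rewrite -/(s i) s0 normr0.
Qed.

End LowerBound.

(** * Upper bound: an explicit flow on a prism *)

Section UpperBound.
Variable R : realType.
Hypotheses (t_gt0 : (0 < t)%N) (t_le : (t <= 2 * k.+1)%N).

Definition prism_tail (e : edge prism) : vertex prism :=
  match e with inl (b, i, _) => (b, i) | inr i => (false, i) end.

Definition prism_head (e : edge prism) : vertex prism :=
  match e with inl (b, i, _) => (b, ordS i) | inr i => (true, i) end.

Lemma prism_tail_head e :
  ends e = finset.setU [set prism_tail e]%SET [set prism_head e]%SET.
Proof. by case: e => [[[b i] j]|i]. Qed.

Definition prism_orientation : orientation prism := Orientation prism_tail_head.

(** There are [k.+2] even and [k.+1] odd positions on the cycle, so the values sum to zero around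
    it. *)
Definition spoke_value (i : nat) : R := if odd i then - (1 + k.+1%:R^-1) else 1.

(* The partial sums [spoke_value 0 + ... + spoke_value i]. *)
Definition rim_value (i : nat) : R :=
  if odd i then - ((i./2).+1%:R / k.+1%:R) else 1 - (i./2)%:R / k.+1%:R.

Lemma rim_valueB (i : 'I_n) : rim_value (ordS i) - rim_value i = spoke_value (ordS i).
Proof.
have k0 : k.+1%:R != 0 :> R by rewrite pnatr_eq0.
have := ltn_ord i; rewrite leq_eqVlt /rim_value /spoke_value /= => /orP[/eqP Ei|lt_i].
  (* At the last position the partial sum is 0, so wrapping around to [rim_value 0 = 1] adds exactly
     [spoke_value 0]. *)
  have -> : (i : nat) = k.+1.*2 by rewrite doubleS; lia.
  by rewrite doubleS modnn /= odd_double doubleK mul0r divff // subr0 subrr subr0.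
rewrite modn_small //= uphalf_half; case: (odd i) => /=; last by rewrite add0n -natr1; field.
by rewrite add1n; field.
Qed.

Lemma rim_value_bound (i : 'I_n) : -1 <= rim_value i <= 1.
Proof.
have k0 : 0 < k.+1%:R :> R by rewrite ltr0n.
rewrite /rim_value; have := ltn_ord i; case: ifP => odd_i lt_i.
  have : 0 <= i./2.+1%:R / k.+1%:R :> R by rewrite divr_ge0.
  have : i./2.+1%:R / k.+1%:R <= 1 :> R.
    by rewrite ler_pdivrMr // mul1r ler_nat ltnS leq_half_double; lia.
  by move: (_ / _) => x *; apply/andP; split; lra.
have : 0 <= i./2%:R / k.+1%:R :> R by rewrite divr_ge0.
have : i./2%:R / k.+1%:R <= 1 :> R.
  by rewrite ler_pdivrMr // mul1r ler_nat leq_half_double; lia.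
by move: (_ / _) => x *; apply/andP; split; lra.
Qed.

(** Since [1 + rim_value i] lies between 0 and 2, rim edges have absolute value between 1 and
    [1 + 2 / t]. A bundle of [t] carries [t + 1 + rim_value i] in absolute value, so consecutive
    bundles differ by a spoke. The rims have opposite signs because spokes leave one and enter the
    other. *)
Definition prism_flow (e : edge prism) : R :=
  match e with
  | inl (b, i, _) => (-1) ^+ (~~ b) * (1 + (1 + rim_value i) / t%:R)
  | inr i => spoke_value i
  end.

Lemma nowhere_zero_prism_flow :
  nowhere_zero_flow (2 + 2 / t%:R) prism_orientation prism_flow.
Proof.
have t0 : 0 < t%:R :> R by rewrite ltr0n.
have t0' := lt0r_neq0 t0.
split=> [|[[[b i] j]|i]|[b i]].
- by rewrite lerDl divr_ge0.
- have /andP[h1 h2] := rim_value_bound i.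
  have h0 : 0 <= (1 + rim_value i) / t%:R by rewrite divr_ge0 //; lra.
  have h3 : (1 + rim_value i) / t%:R <= 2 / t%:R by rewrite ler_pM2r ?invr_gt0 //; lra.
  rewrite normrM normrX normrN1 expr1n mul1r.
  move: (_ / _) (2 / _) h0 h3 => x y x0 xy; rewrite ger0_norm ?addr_ge0 //.
  by apply/andP; split; lra.
- have k0 : 0 < k.+1%:R :> R by rewrite ltr0n.
  have k1 : 0 < k.+1%:R^-1 :> R by rewrite invr_gt0.
  (* The bound [t_le] is what keeps the larger spoke value within [r - 1 = 1 + 2 / t]. *)
  have : k.+1%:R^-1 <= 2 / t%:R :> R.
    by rewrite ler_pdivlMr // mulrC ler_pdivrMr // -natrM ler_nat.
  rewrite /= /spoke_value; move: (2 / _) k.+1%:R^-1 k1 => y x x0 xy.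
  case: odd; last by rewrite normr1 lexx /=; lra.
  rewrite normrN ger0_norm; last by rewrite addr_ge0 // ltW.
  by apply/andP; split; lra.
have [p ->] : exists p, i = ordS p by exists (ord_pred i); rewrite ord_predK.
rewrite big_mkcond [RHS]big_mkcond !big_prism /= !big_bool /=.
have rimT (c : bool) : \sum_i0 \sum_(j < t) (if (c, i0) == (b, ordS p)
     then (-1) ^+ (~~ c) * (1 + (1 + rim_value i0) / t%:R) else 0)
  = if c == b then (-1) ^+ (~~ c) * (t%:R + 1 + rim_value (ordS p)) else 0.
  rewrite (bigD1 (ordS p)) //= [X in _ + X]big1 => [|q /negPf qp]; last first.
    by rewrite big1 // => j _; rewrite xpair_eqE qp andbF.
  rewrite sumr_const card_ord xpair_eqE eqxx andbT addr0.
  by case: eqP => _; rewrite ?mul0rn // -mulr_natl; field.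
have rimH (c : bool) : \sum_i0 \sum_(j < t) (if (c, ordS i0) == (b, ordS p)
     then (-1) ^+ (~~ c) * (1 + (1 + rim_value i0) / t%:R) else 0)
  = if c == b then (-1) ^+ (~~ c) * (t%:R + 1 + rim_value p) else 0.
  rewrite (bigD1 p) //= [X in _ + X]big1 => [|q /negPf qp]; last first.
    by rewrite big1 // => j _; rewrite xpair_eqE (inj_eq (can_inj (@ordSK n))) qp andbF.
  rewrite sumr_const card_ord xpair_eqE eqxx andbT addr0.
  by case: eqP => _; rewrite ?mul0rn // -mulr_natl; field.
have spoke (c : bool) : \sum_(q : 'I_n) (if (c, q) == (b, ordS p) then spoke_value q else 0)
  = if c == b then spoke_value (ordS p) else 0.
  rewrite (bigD1 (ordS p)) //= big1 => [|q /negPf qp]; last by rewrite xpair_eqE qp andbF.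
  by rewrite xpair_eqE eqxx andbT addr0.
rewrite !rimT !rimH !spoke -rim_valueB.
by case: b {rimT rimH spoke} => /=; ring.
Qed.

Lemma circular_flow_number_prism : circular_flow_number R prism = (2 + 2 / t%:R)%:E.
Proof.
apply/eqP; rewrite eq_le; apply/andP; split.
  apply: ereal_inf_lbound; exists (2 + 2 / t%:R) => //.
  by exists prism_orientation, prism_flow; exact: nowhere_zero_prism_flow.
apply/ereal_infP => _ [r [D [phi flow_phi]] <-]; rewrite lee_fin.
have t0 : 0 < t%:R :> R by rewrite ltr0n.
have := prism_flow_ge flow_phi; rewrite natrD natrM => ge_r.
rewrite -(ler_pM2l t0) mulrDr mulrCA divff ?lt0r_neq0 // mulr1 mulrC.
by apply: le_trans ge_r; rewrite mulrC.
Qed.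

End UpperBound.

(** * Edge-chromatic classes of the prisms *)

Lemma class2_prism : (k.+1 < t)%N -> class2 prism.
Proof.
move=> lt_kt; pose X : {set vertex prism} := finset.setX [set false]%SET [set: 'I_n]%SET.
have cX : #|X| = n by rewrite cardsX cards1 cardsT card_ord mul1n.
apply: (class2_overfull regular_prism (X := X)).
(* With [K = k.+1], the rim has [(2 * K + 1) * t] edges, while [2 * t + 1] matchings cover at most
   [(2 * t + 1) * K]; the difference is [t - K > 0]. *)
have: (n * t <= #|[set e : edge prism | ends e \subset X]|)%N.
  rewrite -{1}[n]card_ord -{1}[t]card_ord -card_prod.
  rewrite -(card_imset _ (_ : injective (fun p : 'I_n * 'I_t => inl (false, p.1, p.2) : edge prism))).
    apply: subset_leq_card; apply/fintype.subsetP => _ /imsetP[[i j] _ ->].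
    rewrite finset.inE; apply/fintype.subsetP => [[c q]].
    by rewrite mem_prism_rim !finset.inE => /andP[/eqP ->].
  by move=> [i j] [i' j'] [-> ->].
apply: leq_trans; rewrite cX (_ : n./2 = k.+1); last exact: (half_bit_double k.+1 true).
by rewrite -mul2n; nia.
Qed.

End Prism.
Arguments prism_ends : simpl never.

(* Rim edges between [i] and [i + 1] get the [t] colors from [t * i] on and the spoke at [i]
   gets [t * (i + 1)]; around a vertex these colors are consecutive modulo [2 * t + 1]. *)
Lemma class1_prism (k : nat) : class1 (prism k k.+1).
Proof.
pose n := k.*2.+3; pose t := k.+1.
have n_eq : (2 * t + 1 = n)%N by rewrite /t /n -mul2n; lia.
pose color (e : edge (prism k t)) : nat :=
  match e with inl (_, i, j) => (t * i + j)%N | inr i => (t * i.+1)%N end.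
(* Rank of an edge among the colors at [v]: the rim bundle arriving at [v] comes first, then the one
   starting at [v], then the spoke. *)
pose offset (v : vertex (prism k t)) (e : edge (prism k t)) : nat :=
  match e with inl (_, i, j) => if i == v.2 then (t + j)%N else j | inr _ => (2 * t)%N end.
have colorE (b : bool) (p : 'I_n) (e : edge (prism k t)) :
    ((b, ordS p) : vertex (prism k t)) \in ends e -> color e = (t * p + offset (b, ordS p) e)%N %[mod n].
  (* This survives the wrap-around because the rim length equals the number of colors [n]. *)
  have SE : (t * ordS p = t * p + t %[mod n])%N.
    by rewrite /= modnMmr mulnS addnC.
  case: e => [[[c q] j]|q] /=.
    rewrite mem_prism_rim (inj_eq (can_inj (@ordSK n))) => /andP[_ /orP[]/eqP pq].
      by rewrite -pq eqxx addnA -modnDml SE modnDml.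
    by rewrite pq (negPf (ordS_neq q)).
  rewrite mem_prism_spoke => /eqP <-.
  by rewrite mulnS addnC -modnDml SE modnDml -addnA addnn mul2n.
have offset_lt v e : (offset v e < n)%N.
  by case: e => [[[c q] j]|q] /=; last lia; have := ltn_ord j; case: ifP; lia.
have offset_inj v e f :
    v \in ends e -> v \in ends f -> offset v e = offset v f -> e = f.
  case: v e f => b i [[[c q] j]|q] [[[c' q'] j']|q'] /=; rewrite ?mem_prism_rim ?mem_prism_spoke.
  - move=> /andP[/eqP <- qi] /andP[/eqP <- qi'].
    have := ltn_ord j; have := ltn_ord j'; move: qi qi'.
    rewrite !eq_ordS ![i == _]eq_sym.
    case: (q =P i) => [->|_]; case: (q' =P i) => [->|_] /=; try (by lia).
      by move=> _ _ _ _ /addnI /val_inj ->.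
    by move=> /eqP -> /eqP -> _ _ /val_inj ->.
  - have := ltn_ord j; case: ifP; rewrite -/t; lia.
  - have := ltn_ord j'; case: ifP; rewrite -/t; lia.
  - by move=> /eqP <- /eqP <-.
have n_gt0 : (0 < n)%N by [].
pose c : {ffun edge (prism k t) -> 'I_n} := [ffun e => Ordinal (ltn_pmod (color e) n_gt0)].
apply: (@class1_regular _ n ((false, ord0) : vertex (prism k t))).
  by rewrite -n_eq; apply: regular_prism.
apply/existsP; exists c; apply/proper_edge_coloringP => [[b i]] e f.
have [p ->] : exists p, i = ordS p by exists (ord_pred i); rewrite ord_predK.
move=> ve vf; rewrite !ffunE => /(congr1 val) /=.
rewrite (colorE _ _ _ ve) (colorE _ _ _ vf) => /eqP; rewrite eqn_modDl !modn_small //.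
by move=> /eqP; apply: offset_inj.
Qed.

Theorem proposition3p2 (R : realType) (t : nat) (ht : (1 < t)%N) :
  exists G1 G2 : multigraph,
    [/\ regular (2 * t + 1) G1 /\ regular (2 * t + 1) G2,
        class1 G1,
        class2 G2,
        circular_flow_number R G1 = (2 + 2 / t%:R)%:E
      & circular_flow_number R G2 = (2 + 2 / t%:R)%:E].
Proof.
(* Here [t = k.+2], and the first parameter of [prism] is one less than half the rim length rounded
   down: the rims have lengths [2 * t + 1] and [2 * t - 1]. *)
case: t ht => [|[|k]] // _; exists (prism k.+1 k.+2), (prism k k.+2); split.
- by split; apply: regular_prism.
- exact: class1_prism.
- exact: class2_prism.
- by apply: circular_flow_number_prism; lia.
- by apply: circular_flow_number_prism; lia.
Qed.
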